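(* Consider the problem of minimizing $\varphi(x)$ over $x\in\mathbb{R}^n$ subject to $f(x)\in\Theta$, where $\Theta\subset\mathbb{R}^m$ is closed and convex, and $\varphi:\mathbb{R}^n\to\mathbb{R}$ and $f:\mathbb{R}^n\to\mathbb{R}^m$ are twice differentiable at $\bar x$. Let $L(x,\lambda)=\varphi(x)+\langle\lambda,f(x)\rangle$ and let $(\bar x,\bar\lambda)$ satisfy $\nabla_xL(\bar x,\bar\lambda)=0$, $\bar\lambda\in N_\Theta(f(\bar x))$. Assume that $\Theta$ is parabolically derivable at $f(\bar x)$ for every vector from $K_\Theta(f(\bar x),\bar\lambda)$ and that $\Theta$ is parabolically regular at $f(\bar x)$ for $\bar\lambda$. For each $\rho>0$ consider the function $x\mapsto\mathcal{L}(x,\bar\lambda,\rho)$ on $\mathbb{R}^n$, where $$\mathcal{L}(x,\lambda,\rho)=\varphi(x)+\tfrac{\rho}{2}\big[\operatorname{dist}(f(x)+\rho^{-1}\lambda;\Theta)^2-\|\rho^{-1}\lambda\|^2\big].$$ Then, for each $\rho>0$: (i) The function $x\mapsto\mathcal{L}(x,\bar\lambda,\rho)$ is twice semidifferentiable at $\bar x$, and its second semiderivative is, for any $w\in\mathbb{R}^n$, $$\mathrm{d}^2_x\mathcal{L}(\bar x,\bar\lambda,\rho)(w)=\langle\nabla^2_{xx}L(\bar x,\bar\lambda)w,w\rangle+e_{1/(2\rho)}\big(\mathrm{d}^2\delta_\Theta(f(\bar x),\bar\lambda)\big)(\nabla f(\bar x)w).$$ (ii) As $x\to\bar x$, $$\mathcal{L}(x,\bar\lambda,\rho)=\varphi(\bar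 x)+\tfrac12\mathrm{d}^2_x\mathcal{L}(\bar x,\bar\lambda,\rho)(x-\bar x)+o(\|x-\bar x\|^2).$$ (iii) The function $x\mapsto\mathcal{L}(x,\bar\lambda,\rho)$ is twice epi-differentiable at $\bar x$ for $0$, and its second subderivative at $\bar x$ for $0$, denoted $\mathrm{d}^2_x\mathcal{L}((\bar x,\bar\lambda,\rho),0)$, equals its second semiderivative: $\mathrm{d}^2_x\mathcal{L}((\bar x,\bar\lambda,\rho),0)=\mathrm{d}^2_x\mathcal{L}(\bar x,\bar\lambda,\rho)$.
   Context: $\delta_\Theta$ is the indicator function of $\Theta$; $N_\Theta$ is the normal cone of convex analysis. Moreau envelope: $e_r\psi(x)=\inf_w\{\psi(w)+\frac1{2r}\|w-x\|^2\}$, $r>0$. Tangent cone: $T_\Theta(\bar y)=\{w:\exists t_k\downarrow0,\ w_k\to w,\ \bar y+t_kw_k\in\Theta\}$. Critical cone: $K_\Theta(\bar y,\bar\lambda)=T_\Theta(\bar y)\cap\{\bar\lambda\}^\perp$. Second-order tangent set: $T^2_\Theta(\bar y,w)=\{u:\exists t_k\downarrow0,\ u_k\to u,\ \bar y+t_kw+\tfrac12t_k^2u_k\in\Theta\}$. $\Theta$ is parabolically derivable at $\bar y$ for $w$ if $T^2_\Theta(\bar y,w)\ne\emptyset$ and for each $u\in T^2_\Theta(\bar y,w)$ there are $\varepsilon>0$ and an arc $\xi:[0,\varepsilon]\to\Theta$ with $\xi(0)=\bar y$, $\xi'_+(0)=w$ and $\xi''_+(0):=\lim_{t\downarrow0}\frac{\xi(t)-\xi(0)-t\xi'_+(0)}{\frac12t^2}=u$.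 Second-order difference quotients: $\Delta_t^2\psi(\bar x,\bar v)(u)=\frac{\psi(\bar x+tu)-\psi(\bar x)-t\langle\bar v,u\rangle}{\frac12t^2}$, $t>0$. Second subderivative: $\mathrm{d}^2\psi(\bar x,\bar v)(w)=\liminf_{t\downarrow0,\,u\to w}\Delta_t^2\psi(\bar x,\bar v)(u)$. $\psi$ is twice epi-differentiable at $\bar x$ for $\bar v$ if for every $w$ and every $t_k\downarrow0$ there is $w_k\to w$ with $\Delta_{t_k}^2\psi(\bar x,\bar v)(w_k)\to\mathrm{d}^2\psi(\bar x,\bar v)(w)$. $\Theta$ is parabolically regular at $\bar y\in\Theta$ for $\bar\lambda$ if for every $w$ with $\mathrm{d}^2\delta_\Theta(\bar y,\bar\lambda)(w)<\infty$ there exist $t_k\downarrow0$, $w_k\to w$ with $\Delta^2_{t_k}\delta_\Theta(\bar y,\bar\lambda)(w_k)\to\mathrm{d}^2\delta_\Theta(\bar y,\bar\lambda)(w)$ and $\limsup_k\|w_k-w\|/t_k<\infty$. Twice semidifferentiability: $\psi$ is semidifferentiable at $\bar x$ if $\mathrm{d}\psi(\bar x)(w)=\lim_{t\downarrow0,u\to w}\frac{\psi(\bar x+tu)-\psi(\bar x)}{t}$ exists for every $w$; it is twice semidifferentiable at $\bar x$ if in addition the (finite) limit $\mathrm{d}^2\psi(\bar x)(w):=\lim_{t\downarrow0,u\to w}\frac{\psi(\bar x+tu)-\psi(\bar x)-t\,\mathrm{d}\psi(\bar x)(u)}{\frac12t^2}$, the second semiderivative, exists for every $w$. *)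

(* Defs.v *)
From HB Require Import structures.
From mathcomp Require Import all_boot all_order all_algebra.
From mathcomp Require Import all_classical all_reals all_analysis.

Set Implicit Arguments.
Unset Strict Implicit.
Unset Printing Implicit Defensive.

Import Order.TTheory GRing.Theory Num.Theory.
Import numFieldNormedType.Exports.

Local Open Scope classical_set_scope.
Local Open Scope ring_scope.

Section Euclidean.
Context {R : realType}.

Definition dotv n (u v : 'rV[R]_n) : R := \sum_(i < n) u 0 i * v 0 i.

(* The library norm `|u| on 'rV[R]_n is the sup norm; it induces the same
   topology, but distances and Moreau envelopes need the Euclidean one. *)
Definition enorm n (u : 'rV[R]_n) : R := Num.sqrt (dotv u u).

Definition dist n (y : 'rV[R]_n) (Theta : set 'rV[R]_n) : R :=
  inf [set enorm (y - z) | z in Theta].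

Definition grad n (g : 'rV[R]_n -> R) (x : 'rV[R]_n) : 'rV[R]_n :=
  \row_(i < n) 'd g x (delta_mx 0 i).

(* As for the library's Jacobian, rows are derivatives along the basis vectors:
   w *m hessian g x = 'd (grad g) x w. *)
Definition hessian n (g : 'rV[R]_n -> R) (x : 'rV[R]_n) : 'M[R]_n :=
  'J (grad g) x.

(* Twice differentiability at a point, in the classical sense: differentiability
   around x, and differentiability at x of the derivative. *)
Definition twice_differentiable n (g : 'rV[R]_n -> R) (x : 'rV[R]_n) : Prop :=
  (\forall z \near x, differentiable g z) /\ differentiable (grad g) x.

Definition twice_differentiable_map n m (f : 'rV[R]_n -> 'rV[R]_m)
    (x : 'rV[R]_n) : Prop :=
  (\forall z \near x, differentiable f z) /\ differentiable (jacobian f) x.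

End Euclidean.

Section ConvexGeometry.
Context {R : realType}.
Local Open Scope ereal_scope.

(* The convex-analysis indicator: 0 on Theta, +oo elsewhere. *)
Definition delta n (Theta : set 'rV[R]_n) (y : 'rV[R]_n) : \bar R :=
  if `[< Theta y >] then 0 else +oo.

Definition normal_cone n (Theta : set 'rV[R]_n) (y : 'rV[R]_n) :
    set 'rV[R]_n :=
  [set v | Theta y /\ forall z, Theta z -> (dotv v (z - y) <= 0)%R].

Definition moreau n (r : R) (psi : 'rV[R]_n -> \bar R) (x : 'rV[R]_n) :
    \bar R :=
  ereal_inf [set psi w + ((2 * r)^-1 * enorm (w - x) ^+ 2)%:E | w in setT].

(* t_k decreasing to 0 in the sense of variational analysis: positive and
   convergent to 0, monotonicity not being required. *)
Definition to0 (t : nat -> R) : Prop :=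
  (forall k, (0 < t k)%R) /\ t @ \oo --> (0 : R)%R.

Definition tangent_cone n (Theta : set 'rV[R]_n) (y : 'rV[R]_n) :
    set 'rV[R]_n :=
  [set w | exists t : nat -> R, exists w_ : nat -> 'rV[R]_n,
    [/\ to0 t, w_ @ \oo --> w & forall k, Theta (y + t k *: w_ k)%R]].

Definition critical_cone n (Theta : set 'rV[R]_n) (y lambda : 'rV[R]_n) :
    set 'rV[R]_n :=
  tangent_cone Theta y `&` [set w | dotv lambda w = 0%R].

Definition tangent_set2 n (Theta : set 'rV[R]_n) (y w : 'rV[R]_n) :
    set 'rV[R]_n :=
  [set u | exists t : nat -> R, exists u_ : nat -> 'rV[R]_n,
    [/\ to0 t, u_ @ \oo --> u &
        forall k, Theta (y + t k *: w + (2^-1 * t k ^+ 2) *: u_ k)%R]].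

Definition parabolically_derivable n (Theta : set 'rV[R]_n)
    (y w : 'rV[R]_n) : Prop :=
  tangent_set2 Theta y w !=set0 /\
  forall u, tangent_set2 Theta y w u ->
    exists eps : R, exists xi : R -> 'rV[R]_n,
      [/\ (0 < eps)%R,
          forall t, (0 <= t <= eps)%R -> Theta (xi t),
          xi 0%R = y,
          (t^-1 *: (xi t - xi 0))%R @[t --> 0^'+] --> w &
          ((2^-1 * t ^+ 2)^-1 *: (xi t - xi 0 - t *: w))%R @[t --> 0^'+]
            --> u].

End ConvexGeometry.

Section SecondOrder.
Context {R : realType}.
Local Open Scope ereal_scope.

Definition diffquot2 n (psi : 'rV[R]_n -> \bar R) (x v : 'rV[R]_n)
    (t : R) (u : 'rV[R]_n) : \bar R :=
  (psi (x + t *: u)%R - psi x - (t * dotv v u)%:E) * ((2^-1 * t ^+ 2)^-1)%:E.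

Definition subderiv2 n (psi : 'rV[R]_n -> \bar R) (x v w : 'rV[R]_n) :
    \bar R :=
  limf_einf (fun p : R * 'rV[R]_n => diffquot2 psi x v p.1 p.2)
    (filter_prod (0%R^'+) (nbhs w)).

Definition twice_epi_differentiable n (psi : 'rV[R]_n -> \bar R)
    (x v : 'rV[R]_n) : Prop :=
  forall (w : 'rV[R]_n) (t : nat -> R), to0 t ->
    exists2 w_ : nat -> 'rV[R]_n, w_ @ \oo --> w &
      diffquot2 psi x v (t k) (w_ k) @[k --> \oo] --> subderiv2 psi x v w.

Definition parabolically_regular n (Theta : set 'rV[R]_n)
    (y lambda : 'rV[R]_n) : Prop :=
  forall w, subderiv2 (delta Theta) y lambda w < +oo ->
    exists t : nat -> R, exists w_ : nat -> 'rV[R]_n,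
      [/\ to0 t,
          w_ @ \oo --> w,
          diffquot2 (delta Theta) y lambda (t k) (w_ k) @[k --> \oo]
            --> subderiv2 (delta Theta) y lambda w &
          limn_esup (fun k => (enorm (w_ k - w) / t k)%:E) < +oo].

End SecondOrder.

Section Semidifferentiability.
Context {R : realType}.

(* Limits are taken in R, hence they are finite when they exist. *)
Definition semiquot n (psi : 'rV[R]_n -> R) (x : 'rV[R]_n)
    (p : R * 'rV[R]_n) : R :=
  (psi (x + p.1 *: p.2) - psi x) / p.1.

Definition semideriv n (psi : 'rV[R]_n -> R) (x w : 'rV[R]_n) : R :=
  lim (semiquot psi x p @[p --> filter_prod 0^'+ (nbhs w)]).

Definition semidifferentiable n (psi : 'rV[R]_n -> R) (x : 'rV[R]_n) : Prop :=
  forall w : 'rV[R]_n, cvg (semiquot psi x p @[p --> filter_prod 0^'+ (nbhs w)]).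

Definition semiquot2 n (psi : 'rV[R]_n -> R) (x : 'rV[R]_n)
    (p : R * 'rV[R]_n) : R :=
  (psi (x + p.1 *: p.2) - psi x - p.1 * semideriv psi x p.2)
    / (2^-1 * p.1 ^+ 2).

Definition semideriv2 n (psi : 'rV[R]_n -> R) (x w : 'rV[R]_n) : R :=
  lim (semiquot2 psi x p @[p --> filter_prod 0^'+ (nbhs w)]).

Definition twice_semidifferentiable n (psi : 'rV[R]_n -> R) (x : 'rV[R]_n) :
    Prop :=
  semidifferentiable psi x /\
  forall w : 'rV[R]_n,
    cvg (semiquot2 psi x p @[p --> filter_prod 0^'+ (nbhs w)]).

End Semidifferentiability.

Section Lagrangians.
Context {R : realType} {n m : nat}.
Variables (phi : 'rV[R]_n -> R) (f : 'rV[R]_n -> 'rV[R]_m).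

Definition lagrangian (x : 'rV[R]_n) (lambda : 'rV[R]_m) : R :=
  phi x + dotv lambda (f x).

Definition aug_lagrangian (Theta : set 'rV[R]_m) (x : 'rV[R]_n)
    (lambda : 'rV[R]_m) (rho : R) : R :=
  phi x + rho / 2 * (dist (f x + rho^-1 *: lambda) Theta ^+ 2
                     - enorm (rho^-1 *: lambda) ^+ 2).

End Lagrangians.

(* Main.v *)
Require Import Defs.
From HB Require Import structures.
From mathcomp Require Import all_boot all_order all_algebra.
From mathcomp Require Import all_classical all_reals all_analysis.
From mathcomp Require Import ring lra.

Set Implicit Arguments.
Unset Strict Implicit.
Unset Printing Implicit Defensive.

Import Order.TTheory GRing.Theory Num.Theory.
Import numFieldNormedType.Exports.

Local Open Scope classical_set_scope.
Local Open Scope ring_scope.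

(** Write [y = f xbar], [lam = lbar] and let [g] be the penalty
    [rho/2 (dist(. + lam/rho; Theta)^2 - |lam/rho|^2)], so that the augmented
    Lagrangian is [phi + g o f].  Expanding the square shows that the quotient
    [E_t z = (g (y + t z) - t <lam, z>) / (t^2/2)] is exactly the Moreau envelope of
    the second-order difference quotient of the indicator of [Theta]; the linear
    parts of [g] and [phi] recombine into the Lagrangian, giving
    [AL (xbar + t w) - AL xbar
       = L (xbar + t w) - L xbar + t^2/2 E_t ((f (xbar + t w) - y) / t)].
    The first difference is handled by Taylor's formula.  For the second, [E_t z']
    converges jointly as [t -> 0+], [z' -> z] to the envelope of the second
    subderivative: the lower bound follows by compactness, since the quadratic term
    dominates away from [z] and the indicator quotients are nonnegative; the upper
    bound needs recovery arcs, and these exist because parabolic regularity forces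
    [d^2 delta_Theta (w) = - <lam, u>] for some second-order tangent [u] that
    parabolic derivability realizes by an arc.  All three conclusions follow from
    this joint convergence. *)

(** * Euclidean inner product and norm, compared with the sup norm *)

Section DotProduct.
Context {R : realType} {n : nat}.
Implicit Types u v w : 'rV[R]_n.

Lemma dotvE u v : dotv u v = (u *m v^T) 0 0.
Proof. by rewrite mxE; apply: eq_bigr => i _; rewrite mxE. Qed.

Lemma dotvC u v : dotv u v = dotv v u.
Proof. by apply: eq_bigr => i _; rewrite mulrC. Qed.

Lemma dotvDl u v w : dotv (u + v) w = dotv u w + dotv v w.
Proof. by rewrite !dotvE mulmxDl mxE. Qed.

Lemma dotvZl a u v : dotv (a *: u) v = a * dotv u v.
Proof. by rewrite !dotvE -scalemxAl mxE. Qed.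

Lemma dotvDr u v w : dotv u (v + w) = dotv u v + dotv u w.
Proof. by rewrite dotvC dotvDl !(dotvC u). Qed.

Lemma dotvZr a u v : dotv u (a *: v) = a * dotv u v.
Proof. by rewrite dotvC dotvZl dotvC. Qed.

Lemma dotvNl u v : dotv (- u) v = - dotv u v.
Proof. by rewrite -scaleN1r dotvZl mulN1r. Qed.

Lemma dotvNr u v : dotv u (- v) = - dotv u v.
Proof. by rewrite dotvC dotvNl dotvC. Qed.

Lemma dot0v u : dotv 0 u = 0.
Proof. by rewrite -(scale0r (0 : 'rV[R]_n)) dotvZl mul0r. Qed.

Lemma dotv0 u : dotv u 0 = 0.
Proof. by rewrite dotvC dot0v. Qed.

Lemma dotv_ge0 u : 0 <= dotv u u.
Proof. by apply: sumr_ge0 => i _; rewrite -expr2 sqr_ge0. Qed.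

Lemma enorm_ge0 u : 0 <= enorm u.
Proof. exact: sqrtr_ge0. Qed.

Lemma sqr_enorm u : enorm u ^+ 2 = dotv u u.
Proof. by rewrite sqr_sqrtr // dotv_ge0. Qed.

Lemma normr_coord_le u i : `|u 0 i| <= `|u|.
Proof.
rewrite [leRHS]/Num.norm /= mx_normrE; apply/bigmax_geP; right => /=.
by exists (ord0, i).
Qed.

Lemma norm_le_enorm u : `|u| <= enorm u.
Proof.
rewrite [leLHS]/Num.norm /= mx_normrE; apply: bigmax_le => [|[j i] _ /=].
  exact: enorm_ge0.
rewrite ord1 -sqrtr_sqr ler_wsqrtr // /dotv (bigD1 i) //= -expr2 lerDl.
by apply: sumr_ge0 => k _; rewrite -expr2 sqr_ge0.
Qed.

(** A sup-norm stand-in for Cauchy-Schwarz: the [n] products are bounded one by one, whence the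
    factor [n]. *)
Lemma norm_dotv_le u v : `|dotv u v| <= n%:R * (`|u| * `|v|).
Proof.
apply: (le_trans (ler_norm_sum _ _ _)).
have -> : n%:R * (`|u| * `|v|) = \sum_(i < n) `|u| * `|v|.
  by rewrite sumr_const card_ord mulr_natl.
by apply: ler_sum => i _; rewrite normrM ler_pM // normr_coord_le.
Qed.

Lemma cvg_dotv T (F : set_system T) {FF : Filter F} (u_ v_ : T -> 'rV[R]_n) u v :
  u_ x @[x --> F] --> u -> v_ x @[x --> F] --> v ->
  dotv (u_ x) (v_ x) @[x --> F] --> dotv u v.
Proof.
move=> cu cv; apply: cvg_big => [|i _]; first exact: add_continuous.
by apply: cvgM; [apply: (cvg_comp _ (fun M : 'rV[R]_n => M 0 i) cu)|
  apply: (cvg_comp _ (fun M : 'rV[R]_n => M 0 i) cv)]; exact: coord_continuous.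
Qed.

End DotProduct.

(** * Squared distance to a set *)

Section Dist.
Context {R : realType} {m : nat} (Theta : set 'rV[R]_m).

Lemma sqr_dist_le y z : Theta z -> dist y Theta ^+ 2 <= enorm (y - z) ^+ 2.
Proof.
move=> Tz; rewrite ler_sqr ?nnegrE ?enorm_ge0 //.
  apply: ge_inf; last by exists z.
  by exists 0 => _ [? _ <-]; exact: enorm_ge0.
by apply: lb_le_inf; [exists (enorm (y - z)), z|move=> _ [? _ <-]; exact: enorm_ge0].
Qed.

(** Nonemptiness matters because the infimum of the empty set is [0] by convention. *)
Lemma le_sqr_dist y c : Theta !=set0 ->
  (forall z, Theta z -> c <= enorm (y - z) ^+ 2) -> c <= dist y Theta ^+ 2.
Proof.
move=> [z0 Tz0] cle; have [c0|c0] := leP c 0; first by rewrite (le_trans c0) ?sqr_ge0.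
rewrite -(sqr_sqrtr (ltW c0)) ler_sqr ?nnegrE ?sqrtr_ge0 //.
  apply: lb_le_inf; first by exists (enorm (y - z0)), z0.
  move=> _ [z Tz <-]; rewrite -(ger0_norm (enorm_ge0 (y - z))) -sqrtr_sqr.
  by rewrite ler_wsqrtr // cle.
by apply: lb_le_inf; [exists (enorm (y - z0)), z0|move=> _ [? _ <-]; exact: enorm_ge0].
Qed.

End Dist.

(** * The penalty and its second-order quotient as an infimum over feasible directions *)

Section Penalty.
Context {R : realType} {m : nat} (Theta : set 'rV[R]_m).
Variables (y lam : 'rV[R]_m) (rho : R).

Definition penalty (z : 'rV[R]_m) : R :=
  rho / 2 * (dist (z + rho^-1 *: lam) Theta ^+ 2 - enorm (rho^-1 *: lam) ^+ 2).

(** No value at [y] is subtracted, since [penalty0] shows that it vanishes. *)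
Definition penalty_quot (t : R) (z : 'rV[R]_m) : R :=
  (penalty (y + t *: z) - t * dotv lam z) / (2^-1 * t ^+ 2).

(** For feasible [u] this is the objective of the Moreau envelope: the first term is the indicator
    quotient of [diffquot2_delta], and [rho] is the weight belonging to the parameter
    [1 / (2 * rho)]. *)
Definition shifted_cost (t : R) (z u : 'rV[R]_m) : R :=
  - (2 * dotv lam u / t) + rho * enorm (u - z) ^+ 2.

Hypotheses (rho_gt0 : 0 < rho) (ylam : normal_cone Theta y lam).

(** The vector on the left is [rho^-1 *: lam + t *: (z - u)]. After multiplication by [rho / 2], the
    cross term yields both the linear part removed in [penalty_quot] and the indicator quotient. *)
Lemma sqr_enorm_shift t z u :
  enorm (y + t *: z + rho^-1 *: lam - (y + t *: u)) ^+ 2 =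
  enorm (rho^-1 *: lam) ^+ 2 + 2 * t / rho * (dotv lam z - dotv lam u)
  + t ^+ 2 * enorm (u - z) ^+ 2.
Proof.
rewrite (_ : y + _ + _ - _ = rho^-1 *: lam + t *: (z - u)); last first.
  by apply/rowP => i; rewrite !mxE; ring.
rewrite !sqr_enorm !(dotvDl, dotvDr, dotvZl, dotvZr, dotvNl, dotvNr).
by rewrite (dotvC z lam) (dotvC u lam) (dotvC z u); ring.
Qed.

(** As [lam] is normal to [Theta] at [y], the point [y] is a nearest point of [Theta] to
    [y + rho^-1 *: lam]. *)
Lemma penalty0 : penalty y = 0.
Proof.
have [Ty lam_le] := ylam; rewrite /penalty.
suff -> : dist (y + rho^-1 *: lam) Theta ^+ 2 = enorm (rho^-1 *: lam) ^+ 2.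
  by rewrite subrr mulr0.
apply/eqP; rewrite eq_le; apply/andP; split.
  by rewrite (le_trans (sqr_dist_le _ Ty)) // addrAC subrr add0r.
apply: le_sqr_dist => [|z Tz]; first by exists y.
(* With [t = 1] and direction [z - y], the cross term is nonnegative by normality of [lam]. *)
have := sqr_enorm_shift 1 0 (z - y); rewrite !scale1r addr0.
rewrite [y + (z - y)]addrC subrK => ->.
rewrite dotv0 sub0r mulr1 expr1n mul1r -addrA lerDl addr_ge0 ?sqr_ge0 //.
by rewrite mulr_ge0 ?oppr_ge0 ?lam_le // divr_ge0 // ltW.
Qed.

(** Each feasible [u] gives a competitor for the distance; this is one half of the envelope
    identity. *)
Lemma penalty_quot_le t z u : 0 < t -> Theta (y + t *: u) ->
  penalty_quot t z <= shifted_cost t z u.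
Proof.
move=> t0 Tu; rewrite /penalty_quot /shifted_cost ler_pdivrMr; last first.
  by rewrite mulr_gt0 // exprn_gt0.
rewrite lerBlDr /penalty.
have := sqr_dist_le (y + t *: z + rho^-1 *: lam) Tu.
rewrite sqr_enorm_shift; set N := enorm (rho^-1 *: lam) ^+ 2; set d := _ ^+ 2.
set a := 2 * t / _ * _; set b := _ ^+ 2 * _ => dle.
apply: (@le_trans _ _ (rho / 2 * (a + b))).
  by rewrite ler_pM2l ?divr_gt0 //; lra.
by rewrite le_eqVlt /a /b; apply/orP; left; apply/eqP; field; rewrite !gt_eqF.
Qed.

(** The other half: for [t > 0] every point of [Theta] has the form [y + t *: u], so a bound over
    feasible directions controls the distance. *)
Lemma le_penalty_quot t z c : 0 < t ->
  (forall u, Theta (y + t *: u) -> c <= shifted_cost t z u) ->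
  c <= penalty_quot t z.
Proof.
move=> t0 cle; rewrite /penalty_quot ler_pdivlMr; last first.
  by rewrite mulr_gt0 // exprn_gt0.
rewrite lerBrDr /penalty -ler_pdivrMl ?divr_gt0 // lerBrDr.
apply: le_sqr_dist => [|v Tv]; first by exists y; have [] := ylam.
have vE : v = y + t *: (t^-1 *: (v - y)).
  by rewrite scalerA divff ?gt_eqF // scale1r addrC subrK.
rewrite [v in leRHS]vE sqr_enorm_shift.
set u := t^-1 *: _ in vE *; move: (cle u); rewrite -vE => /(_ Tv).
rewrite /shifted_cost => cu.
have : (rho / 2)^-1 * (c * (2^-1 * t ^+ 2)) <=
    t ^+ 2 / rho * (- (2 * dotv lam u / t) + rho * enorm (u - z) ^+ 2).
  rewrite (_ : _ * (c * _) = t ^+ 2 / rho * c); last by field; rewrite gt_eqF.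
  by rewrite ler_pM2l // divr_gt0 // exprn_gt0.
set e := enorm (u - z) ^+ 2; set a := dotv lam u; set b := dotv lam z.
rewrite (_ : t ^+ 2 / rho * _ = - (2 * t / rho * a) + t ^+ 2 * e); last first.
  by field; rewrite !gt_eqF.
rewrite (_ : (rho / 2)^-1 * (_ + t * b) =
  (rho / 2)^-1 * (c * (2^-1 * t ^+ 2)) + 2 * t / rho * b); last first.
  by field; rewrite !gt_eqF.
lra.
Qed.

End Penalty.

(** * One-sided bounds for lower and upper limits along a filter *)

Section LimitInferior.
Context {R : realType} {T : choiceType} {X : filteredType T}.
Local Open Scope ereal_scope.

Lemma limf_esup_lt (f : X -> \bar R) (F : set_system X) {FF : Filter F} c :
  limf_esup f F < c -> \forall x \near F, f x < c.
Proof.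
move=> /ereal_inf_lt[_ [V FV <-]] Vc; apply: (filterS _ FV) => x Vx.
by apply: le_lt_trans Vc; apply: ereal_sup_ubound; exists x.
Qed.

Lemma lt_limf_einf (f : X -> \bar R) (F : set_system X) {FF : Filter F} c :
  c < limf_einf f F -> \forall x \near F, c < f x.
Proof.
rewrite limf_einfE => /ereal_sup_gt[_ [V FV <-]] Vc; apply: (filterS _ FV) => x Vx.
by apply: (lt_le_trans Vc); apply: ereal_inf_lbound; exists x.
Qed.

Lemma le_limf_einf (f : X -> \bar R) (F : set_system X) {FF : Filter F} c :
  (\forall x \near F, c <= f x) -> c <= limf_einf f F.
Proof.
move=> Fc; rewrite limf_einfE; apply: le_trans (ereal_sup_ubound _); last first.
  by exists [set x | c <= f x].
by apply: le_ereal_inf_tmp => _ [x cx <-].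
Qed.

Lemma limf_einf_le (f : X -> \bar R) (F : set_system X) {FF : Filter F} c :
  (forall V, F V -> exists2 x, V x & f x <= c) -> limf_einf f F <= c.
Proof.
move=> Vc; rewrite limf_einfE; apply: ge_ereal_sup => _ [V /Vc[x Vx fx] <-].
by apply: (le_trans _ fx); apply: ereal_inf_lbound; exists x.
Qed.

End LimitInferior.

Lemma to0_cvg_at_right (R : realType) (t : nat -> R) :
  to0 t -> t k @[k --> \oo] --> (0 : R)^'+.
Proof.
move=> [t0 ct] A /= A0.
have : \forall k \near \oo, 0 < t k -> A (t k) by apply: (ct [set x | 0 < x -> A x]); exact: A0.
by apply: filterS => k; exact.
Qed.

(** * Second-order quotients of the indicator at a normal vector *)

Section IndicatorSubderivative.
Context {R : realType} {m : nat} (Theta : set 'rV[R]_m) (y lam : 'rV[R]_m).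
Hypothesis ylam : normal_cone Theta y lam.

Local Notation D := (subderiv2 (delta Theta) y lam).

Lemma diffquot2_delta t u : Theta (y + t *: u) ->
  diffquot2 (delta Theta) y lam t u = (- (2 * dotv lam u / t))%:E.
Proof.
move=> Tu; have [Ty _] := ylam; rewrite /diffquot2 /delta !asboolT //=.
rewrite -!EFinB -EFinM; congr (_%:E).
(* At [t = 0] both sides vanish, the inverse of [0] being [0]. *)
have [->|t0] := eqVneq t 0; first by rewrite expr0n !mulr0 !invr0 !mulr0 oppr0.
by field.
Qed.

Lemma diffquot2_deltaN t u : 0 < t -> ~ Theta (y + t *: u) ->
  diffquot2 (delta Theta) y lam t u = +oo%E.
Proof.
move=> t0 Tu; have [Ty _] := ylam; rewrite /diffquot2 /delta asboolF // asboolT //=.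
by rewrite sube0 /= gt0_mulye // lte_fin invr_gt0 mulr_gt0 ?exprn_gt0.
Qed.

Lemma dotv_feasible_le0 t u : 0 < t -> Theta (y + t *: u) -> dotv lam u <= 0.
Proof.
move=> t0 Tu; have [_ /(_ _ Tu)] := ylam.
by rewrite addrAC subrr add0r dotvZr pmulr_rle0.
Qed.

Lemma indicator_cost_ge0 t u : 0 < t -> Theta (y + t *: u) ->
  0 <= - (2 * dotv lam u / t).
Proof.
move=> t0 Tu; rewrite -mulNr divr_ge0 ?(ltW t0) //.
by rewrite oppr_ge0 pmulr_rle0 // (dotv_feasible_le0 t0).
Qed.

Lemma diffquot2_delta_ge0 t u : 0 < t ->
  (0 <= diffquot2 (delta Theta) y lam t u)%E.
Proof.
move=> t0; have [Tu|Tu] := pselect (Theta (y + t *: u)).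
  by rewrite diffquot2_delta // lee_fin indicator_cost_ge0.
by rewrite diffquot2_deltaN // leey.
Qed.

Lemma near_prod_pos w :
  \forall p \near filter_prod ((0 : R)^'+) (nbhs (w : 'rV[R]_m)), 0 < p.1.
Proof.
exists ([set t : R | 0 < t], setT) => /=; first by split; [exact: nbhs_right_gt|exact: filterT].
by case=> a b [].
Qed.

Lemma subderiv2_delta_ge0 w : (0 <= D w)%E.
Proof.
apply: le_limf_einf; apply: filterS (near_prod_pos w) => p.
exact: diffquot2_delta_ge0.
Qed.

(** The direction [0] is feasible with quotient [0] for every [t]. This is what makes the envelope
    finite everywhere. *)
Lemma subderiv2_delta0 : (D 0 <= 0)%E.
Proof.
apply: limf_einf_le => V [[A B] /= [A0 B0] ABV].
have [t At] : exists t, A t := filter_ex A0.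
exists (t, 0); first by apply: ABV; split => //=; exact: nbhs_singleton.
have [Ty _] := ylam.
by rewrite /= diffquot2_delta ?scaler0 ?addr0 // dotv0 mulr0 mul0r oppr0.
Qed.

End IndicatorSubderivative.

(** * Compactness of balls and extraction of subsequences *)

Lemma closed_norm_le (R : realType) n M : closed [set v : 'rV[R]_n | `|v| <= M].
Proof.
apply: (@preimage_closed _ _ (@Num.norm R 'rV[R]_n) [set x | x <= M]) => [x _|].
  exact: norm_continuous.
exact: closed_le.
Qed.

Lemma compact_norm_le (R : realType) n M : compact [set v : 'rV[R]_n | `|v| <= M].
Proof.
apply: bounded_closed_compact; last exact: closed_norm_le.
exists M; split => [|x Mx v /= /le_trans]; first exact: num_real.
by apply; exact: ltW.
Qed.

(** Compactness gives a cluster point [l], and the [j]-th index is chosen beyond [j] and within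
    [1 / (j + 1)] of [l]. Imposing [P] at every chosen index suits tangent sets, which ask for
    membership at all indices. *)
Lemma bounded_cvg_subseq (R : realType) n (u : nat -> 'rV[R]_n) (P : nat -> Prop) M :
  (\forall k \near \oo, P k) -> (\forall k \near \oo, `|u k| <= M) ->
  exists l : 'rV[R]_n, exists k : nat -> nat, [/\ forall j, P (k j),
    k j @[j --> \oo] --> \oo & u (k j) @[j --> \oo] --> l].
Proof.
move=> nP nM; have [l [_ clu]] := @compact_norm_le R n M (u x @[x --> \oo]) _ nM.
have ex j : exists k, [/\ P k, (j <= k)%N & ball l j.+1%:R^-1 (u k)].
  have uA : nbhs (u x @[x --> \oo]) (u @` [set k | P k /\ (j <= k)%N]).
    have : \forall k \near \oo, P k /\ (j <= k)%N.
      by apply: filterI => //; exact: nbhs_infty_ge.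
    by apply: filterS => k Pk; exists k.
  have [|_ [[k [Pk jk] <-] lk]] := clu _ (ball l j.+1%:R^-1) uA.
    exact: nbhsx_ballx.
  by exists k.
exists l; have [k kP] := choice ex; exists k; split => [j|A /= [N _ NA]|].
- by have [] := kP j.
- exists N => // j /= Nj; apply: NA => /=.
  by have [_ jk _] := kP j; exact: leq_trans jk.
apply/cvgrPdist_lt => e e0; near=> j.
have [_ _] := kP j; rewrite -ball_normE /= => /lt_trans; apply.
near: j; exact: near_infty_natSinv_lt (PosNum e0).
Unshelve. all: by end_near. Qed.

(** * Recovery arcs from parabolic regularity and parabolic derivability *)

Section IndicatorRecovery.
Context {R : realType} {m : nat} (Theta : set 'rV[R]_m) (y lam : 'rV[R]_m).
Hypothesis ylam : normal_cone Theta y lam.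
Hypothesis parab_deriv : forall w, critical_cone Theta y lam w ->
  parabolically_derivable Theta y w.
Hypothesis parab_reg : parabolically_regular Theta y lam.

Local Notation D := (subderiv2 (delta Theta) y lam).

(** Regularity keeps the parabolic corrections [2 (v k - w) / t k] bounded along a sequence
    attaining [D w]; a limit of them is the second-order tangent sought. *)
Lemma regular_tangent_set2 w : (D w < +oo)%E ->
  [/\ dotv lam w = 0, tangent_cone Theta y w &
    exists2 u, tangent_set2 Theta y w u & D w = (- dotv lam u)%:E].
Proof.
move=> Dw; have [t [v [t0 cv cD nb]]] := parab_reg Dw.
have [tp ct] := t0.
have [d Dd] : exists d, D w = d%:E.
  exists (fine (D w)); rewrite fineK // ge0_fin_numE //.
  exact: (subderiv2_delta_ge0 ylam).
rewrite Dd in cD *.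
have [M nM] : exists M : R, \forall k \near \oo, enorm (v k - w) / t k <= M.
  have [M ltM] : exists M : R, (limn_esup (fun k => (enorm (v k - w) / t k)%:E) < M%:E)%E.
    move: nb; case: (limn_esup _) => [r _| //|_].
      by exists (r + 1); rewrite lte_fin ltrDl.
    by exists 0; rewrite ltNyr.
  by exists M; apply: filterS (limf_esup_lt ltM) => k; rewrite lte_fin => /ltW.
(* An infeasible direction has quotient [+oo], whereas the quotients tend to the finite [d]. *)
have feas : \forall k \near \oo, Theta (y + t k *: v k).
  have : \forall k \near \oo, (diffquot2 (delta Theta) y lam (t k) (v k) < (d + 1)%:E)%E.
    apply: (cD [set x | (x < (d + 1)%:E)%E]).
    by apply: open_ereal_lt'; rewrite lte_fin ltrDl.
  apply: filterS => k; apply: contraPP => Tk.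
  by rewrite (diffquot2_deltaN ylam).
pose q k := - (2 * dotv lam (v k) / t k).
have cq : q k @[k --> \oo] --> d.
  apply: cvg_trans (fine_cvg cD); apply: near_eq_cvg.
  by apply: filterS feas => k Tk; rewrite /= (diffquot2_delta ylam).
(* Chosen so that [t k *: w + (2^-1 * t k ^+ 2) *: u k = t k *: v k]. *)
pose u k := (2 / t k) *: (v k - w).
(* Here [dotv lam (v k) = - q k * t k / 2], with [q k] convergent and [t k] tending to [0]. *)
have lamw : dotv lam w = 0.
  have c1 : dotv lam (v k) @[k --> \oo] --> dotv lam w.
    by apply: cvg_dotv => //; exact: cvg_cst.
  have c2 : dotv lam (v k) @[k --> \oo] --> - (d * 0) / 2.
    rewrite (_ : (fun k => dotv lam (v k)) = (fun k => - (q k * t k) / 2)).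
      by apply: cvgMr_tmp; apply: cvgN; exact: cvgM.
    by apply/funext => k; rewrite /q; field; rewrite gt_eqF.
  by rewrite (cvg_unique _ c1 c2) // mulr0 oppr0 mul0r.
have quk k : q k = - dotv lam (u k).
  rewrite /q /u dotvZr dotvDr dotvNr lamw subr0.
  by field; rewrite gt_eqF.
have uM : \forall k \near \oo, `|u k| <= 2 * M.
  apply: filterS nM => k kM; rewrite /u normrZ gtr0_norm ?divr_gt0 //.
  rewrite -mulrA ler_pM2l // mulrC; apply: le_trans kM.
  by rewrite ler_pM2r ?invr_gt0 // norm_le_enorm.
have [l [s [Ts cs cu]]] := bounded_cvg_subseq feas uM.
have t0s : to0 (t \o s).
  by split => [k|]; [exact: tp|exact: (cvg_comp s t cs ct)].
split => //.
  by exists (t \o s), (v \o s); split => //; exact: (cvg_comp s v cs cv).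
exists l.
  exists (t \o s), (u \o s); split => // k /=.
  rewrite -addrA (_ : t (s k) *: w + _ = t (s k) *: v (s k)) //.
  apply/rowP => i; rewrite !mxE; field; exact: lt0r_neq0.
congr (_%:E).
have c1 : - dotv lam (u (s k)) @[k --> \oo] --> - dotv lam l.
  by apply: cvgN; apply: cvg_dotv => //; exact: cvg_cst.
have c2 : - dotv lam (u (s k)) @[k --> \oo] --> d.
  under eq_fun do rewrite -quk.
  exact: (cvg_comp s q cs cq).
exact: (cvg_unique _ c2 c1).
Unshelve. all: by end_near. Qed.

(** The directions follow the arc [xi] realizing [u], so that [y + t *: v t = xi t]. Its first
    derivative gives the limit [w]; its second, with [dotv lam w = 0], gives the quotients. The arc
    serves all small [t], where regularity alone offers one sequence. *)
Lemma indicator_recovery w : (D w < +oo)%E ->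
  exists v : R -> 'rV[R]_m, [/\ v t @[t --> 0^'+] --> w,
    \forall t \near 0^'+, Theta (y + t *: v t) &
    - (2 * dotv lam (v t) / t) @[t --> 0^'+] --> fine (D w)].
Proof.
move=> /regular_tangent_set2[lamw Tw [u Tu ->]] /=.
have [_ /(_ u Tu)[eps [xi [eps0 Txi xi0 cw cu]]]] := parab_deriv (conj Tw lamw).
exists (fun t => t^-1 *: (xi t - y)); split; first by rewrite -xi0.
  near=> t; have t0 : 0 < t by near: t; exact: nbhs_right_gt.
  rewrite scalerA divff ?gt_eqF // scale1r addrC subrK; apply: Txi.
  by rewrite (ltW t0) /=; near: t; exact: nbhs_right_le.
have cu' : - dotv lam ((2^-1 * t ^+ 2)^-1 *: (xi t - xi 0 - t *: w))
    @[t --> 0^'+] --> - dotv lam u.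
  by apply: cvgN; apply: cvg_dotv => //; exact: cvg_cst.
apply: cvg_trans cu'; apply: near_eq_cvg; near=> t.
have t0 : 0 < t by near: t; exact: nbhs_right_gt.
rewrite !dotvZr [dotv lam (_ - t *: w)]dotvDr dotvNr dotvZr lamw xi0.
by field; rewrite gt_eqF.
Unshelve. all: by end_near. Qed.

End IndicatorRecovery.

(** * Joint convergence of the penalty quotients to the Moreau envelope *)

Section EnvelopeConvergence.
Context {R : realType} {m : nat} (Theta : set 'rV[R]_m) (y lam : 'rV[R]_m).
Variable rho : R.
Hypothesis rho_gt0 : 0 < rho.
Hypothesis ylam : normal_cone Theta y lam.

Local Notation D := (subderiv2 (delta Theta) y lam).
Local Notation envelope := (moreau (1 / (2 * rho)) D).
Local Notation at0 z := (filter_prod (0 : R)^'+ (nbhs (z : 'rV[R]_m))).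

(** For [r = 1 / (2 * rho)] the envelope weight [(2 * r)^-1] is [rho]. *)
Lemma moreau_le z w : (envelope z <= D w + (rho * enorm (w - z) ^+ 2)%:E)%E.
Proof.
apply: ereal_inf_lbound; exists w => //; congr (_ + (_ * _)%:E)%E.
by field; rewrite gt_eqF.
Qed.

Lemma moreau_lt z a : (envelope z < a)%E ->
  exists w, (D w + (rho * enorm (w - z) ^+ 2)%:E < a)%E.
Proof.
move=> /ereal_inf_lt[_ [w _ <-]] wa; exists w; apply: le_lt_trans wa.
rewrite le_eqVlt; apply/orP; left; apply/eqP; congr (_ + (_ * _)%:E)%E.
by field; rewrite gt_eqF.
Qed.

Lemma moreau_fin_num z : envelope z \is a fin_num.
Proof.
rewrite ge0_fin_numE.
  apply: (le_lt_trans (moreau_le z 0)).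
  apply: (@le_lt_trans _ _ (0 + (rho * enorm (0 - z) ^+ 2)%:E)%E).
    by apply: leeD2r; exact: subderiv2_delta0 ylam.
  by rewrite add0e ltry.
apply: le_ereal_inf_tmp => _ [w _ <-]; apply: adde_ge0.
  exact: (subderiv2_delta_ge0 ylam).
by rewrite lee_fin mulr_ge0 ?sqr_ge0 // invr_ge0 mulr_ge0 // divr_ge0 // mulr_ge0 // ltW.
Qed.

(** The lower limit defining [D u] bounds the indicator quotients near [u], and the quadratic term
    is continuous. The bound holds on a neighbourhood of [u], as a covering argument requires. *)
Lemma shifted_cost_lower c z u : (c%:E < D u + (rho * enorm (u - z) ^+ 2)%:E)%E ->
  \forall u' \near u & p \near at0 z,
    Theta (y + p.1 *: u') -> c <= shifted_cost lam rho p.1 p.2 u'.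
Proof.
set s := rho * _ => cu.
(* [c1] lies strictly between [c - s] and [D u], leaving room for the quadratic term to vary around
   [s]. *)
have [c1 c1s c1D] : exists2 c1, c - s < c1 & (c1%:E < D u)%E.
  have := subderiv2_delta_ge0 ylam u; move: cu; case: (D u) => [d| |//].
    rewrite -EFinD lte_fin => cd _; exists ((c - s + d) / 2); last rewrite lte_fin; lra.
  by move=> _ _; exists (c - s + 1); [rewrite ltrDl|rewrite ltry].
have cv1 : (fun x : 'rV[R]_m * (R * 'rV[R]_m) => (x.2.1, x.1)) @
    filter_prod (nbhs u) (at0 z) --> at0 u.
  have c21 : x.2.1 @[x --> filter_prod (nbhs u) (at0 z)] --> (0 : R)^'+.
    exact: (cvg_comp _ _ cvg_snd cvg_fst).
  exact: (cvg_pair c21 cvg_fst).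
have cv2 : rho * enorm (x.1 - x.2.2) ^+ 2 @[x --> filter_prod (nbhs u) (at0 z)] --> s.
  under eq_fun do rewrite sqr_enorm.
  rewrite /s sqr_enorm; apply: cvgMl_tmp.
  have cB : x.1 - x.2.2 @[x --> filter_prod (nbhs u) (at0 z)] --> u - z.
    apply: cvgB; first exact: cvg_fst.
    exact: (cvg_comp _ _ cvg_snd cvg_snd).
  exact: cvg_dotv.
have n1 : \forall x \near filter_prod (nbhs u) (at0 z),
    (c1%:E < diffquot2 (delta Theta) y lam x.2.1 x.1)%E.
  have n0 : \forall p \near at0 u, (c1%:E < diffquot2 (delta Theta) y lam p.1 p.2)%E.
    exact: lt_limf_einf c1D.
  exact: (cv1 _ n0).
have n2 : \forall x \near filter_prod (nbhs u) (at0 z), c - c1 < rho * enorm (x.1 - x.2.2) ^+ 2.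
  by apply: (cvgr_gt s cv2); lra.
apply: filterS2 n1 n2 => -[u' [t z']] /= n1 n2 Tu.
move: n1; rewrite (diffquot2_delta ylam) // lte_fin /shifted_cost => n1.
by rewrite ltW // -[ltLHS](subrK c1) addrC ltrD.
Qed.

(** Compactness makes the local bounds uniform over [u] in a ball; outside it the quadratic term
    alone exceeds [c], the indicator part being nonnegative. *)
Lemma penalty_quot_lower c z : (c%:E < envelope z)%E ->
  \forall p \near at0 z, c <= penalty_quot Theta y lam rho p.1 p.2.
Proof.
(* If [|u| > M] and [|v - z| < 1], then [|u - v| >= 1 + a] with [a = |c| / rho], and
   [rho * (1 + a) ^+ 2 >= |c|]. *)
move=> cz; pose M := 2 + `|c| / rho + `|z|.
have near_le := (@compact_near_coveringP _ _).1 (@compact_norm_le R m M)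
  _ (at0 z) (fun p u => Theta (y + p.1 *: u) -> c <= shifted_cost lam rho p.1 p.2 u) _ _.
have {}near_le : \forall p \near at0 z, forall u, `|u| <= M ->
    Theta (y + p.1 *: u) -> c <= shifted_cost lam rho p.1 p.2 u.
  apply: near_le => u _; apply: shifted_cost_lower.
  exact: (lt_le_trans cz (moreau_le z u)).
have nz : \forall p \near at0 z, `|p.2 - z| < 1.
  have : \forall v \near z, `|v - z| < 1.
    by apply: filterS (nbhsx_ballx z 1 ltr01) => v; rewrite -ball_normE /= distrC.
  exact: cvg_snd.
apply: filterS3 near_le nz (near_prod_pos z) => -[t v] /= near_le vz t0.
apply: le_penalty_quot => // u Tu; have [uM|uM] := leP `|u| M; first exact: near_le.
rewrite /shifted_cost; have := indicator_cost_ge0 ylam t0 Tu.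
set a := `|c| / rho in M uM near_le.
have a0 : 0 <= a by rewrite divr_ge0 // ltW.
have uv : 1 + a <= enorm (u - v).
  apply: le_trans (norm_le_enorm _);
  have -> : u - v = u - z - (v - z) by apply/rowP => i; rewrite !mxE; ring.
  have := lerB_dist (u - z) (v - z); have := lerB_dist u z.
  by rewrite /M in uM; lra.
have cr : c <= rho * enorm (u - v) ^+ 2.
  apply: (@le_trans _ _ (rho * a)); first by rewrite /a mulrC divfK ?gt_eqF // ler_norm.
  rewrite ler_pM2l //; apply: (@le_trans _ _ ((1 + a) ^+ 2)).
    by nra.
  by rewrite ler_sqr // nnegrE ?enorm_ge0 // addr_ge0.
lra.
Qed.

Hypothesis parab_deriv : forall w, critical_cone Theta y lam w ->
  parabolically_derivable Theta y w.
Hypothesis parab_reg : parabolically_regular Theta y lam.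

(** Some [w] has envelope objective below [c], hence finite [D w]; its recovery arc provides a
    competitor at every small [t], independently of the direction [p.2]. *)
Lemma penalty_quot_upper c z : (envelope z < c%:E)%E ->
  \forall p \near at0 z, penalty_quot Theta y lam rho p.1 p.2 < c.
Proof.
move=> /moreau_lt[w wc].
have Dw : (D w < +oo)%E.
  by move: wc; case: (D w) => [d|//|//] _; rewrite ltry.
have [v [cv Tv cd]] := indicator_recovery ylam parab_deriv parab_reg Dw.
have {}wc : fine (D w) + rho * enorm (w - z) ^+ 2 < c.
  rewrite -lte_fin EFinD fineK // ge0_fin_numE //.
  exact: (subderiv2_delta_ge0 ylam).
have cvc : shifted_cost lam rho p.1 p.2 (v p.1) @[p --> at0 z] -->
    fine (D w) + rho * enorm (w - z) ^+ 2.
  apply: cvgD; first exact: (cvg_comp _ _ cvg_fst cd).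
  under eq_fun do rewrite sqr_enorm.
  rewrite sqr_enorm; apply: cvgMl_tmp.
  have cB : v p.1 - p.2 @[p --> at0 z] --> w - z.
    apply: cvgB; last exact: cvg_snd.
    exact: (cvg_comp _ _ cvg_fst cv).
  exact: cvg_dotv.
have n1 : \forall p \near at0 z, shifted_cost lam rho p.1 p.2 (v p.1) < c.
  exact: (cvgr_lt _ cvc _ wc).
have n2 : \forall p \near at0 z, Theta (y + p.1 *: v p.1).
  exact: (cvg_fst Tv).
apply: filterS3 n1 n2 (near_prod_pos z) => -[t u] /= n1 n2 t0.
by apply: le_lt_trans n1; exact: penalty_quot_le.
Qed.

Lemma penalty_quot_cvg z :
  penalty_quot Theta y lam rho p.1 p.2 @[p --> at0 z] --> fine (envelope z).
Proof.
apply/cvgrPdist_le => e e0.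
have lo : ((fine (envelope z) - e)%:E < envelope z)%E.
  by rewrite -[ltRHS](fineK (moreau_fin_num z)) lte_fin ltrBlDr ltrDl.
have up : (envelope z < (fine (envelope z) + e)%:E)%E.
  by rewrite -[ltLHS](fineK (moreau_fin_num z)) lte_fin ltrDl.
apply: filterS2 (penalty_quot_lower lo) (penalty_quot_upper up) => p p1 p2.
by rewrite ler_distl; lra.
Qed.

End EnvelopeConvergence.

(** * Differentiability read along [t -> 0+] and directions tending to [w] *)

Section JointLimits.
Context {R : realType} {n : nat}.
Local Notation at0 z := (filter_prod (0 : R)^'+ (nbhs (z : 'rV[R]_n))).

Lemma cvg_scale_at0 (w : 'rV[R]_n) : p.1 *: p.2 @[p --> at0 w] --> (0 : 'rV[R]_n).
Proof.
rewrite -(scale0r w); apply: cvgZ; last exact: cvg_snd.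
exact: (cvg_comp _ _ cvg_fst (cvg_at_right_filter cvg_id)).
Qed.

Lemma cvg_fst_at0 (w : 'rV[R]_n) : p.1 @[p --> at0 w] --> (0 : R).
Proof. exact: (cvg_comp _ _ cvg_fst (cvg_at_right_filter cvg_id)). Qed.

(** Near [w] the increments [t *: v] have norm at most [t * (|w| + 1)], so a remainder negligible
    against [|h| ^+ k] is negligible against [t ^+ k]. *)
Lemma littleo_quot_cvg0 (V : normedModType R) (r : 'rV[R]_n -> V) k w :
  (forall e, 0 < e -> \forall h \near (0 : 'rV[R]_n), `|r h| <= e * `|h| ^+ k) ->
  p.1 ^- k *: r (p.1 *: p.2) @[p --> at0 w] --> (0 : V).
Proof.
move=> ro; apply/cvgr0Pnorm_le => e e0.
have M0 : 0 < (`|w| + 1) ^+ k by rewrite exprn_gt0 // ltr_wpDl.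
have n1 : \forall p \near at0 w, `|r (p.1 *: p.2)| <=
    e / (`|w| + 1) ^+ k * `|p.1 *: p.2| ^+ k.
  exact: (cvg_scale_at0 w (ro _ (divr_gt0 e0 M0))).
have n2 : \forall p \near at0 w, `|p.2| <= `|w| + 1.
  have : `|p.2| @[p --> at0 w] --> `|w| by apply: cvg_norm; exact: cvg_snd.
  by move/cvgr_le; apply; rewrite ltrDl.
apply: filterS3 n1 n2 (near_prod_pos w) => -[t v] /= rt vw t0.
rewrite normrZ normfV gtr0_norm ?exprn_gt0 //.
rewrite ler_pdivrMl ?exprn_gt0 //; apply: (le_trans rt).
rewrite normrZ gtr0_norm // exprMn mulrCA ler_pM2l ?exprn_gt0 //.
rewrite -mulrA ger_pMr // mulrC ler_pdivrMr // mul1r.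
by rewrite lerXn2r // nnegrE ?normr_ge0 // addr_ge0.
Qed.

Lemma diff_littleo (V : normedModType R) (f : 'rV[R]_n -> V) x : differentiable f x ->
  forall e, 0 < e -> \forall h \near (0 : 'rV[R]_n), `|f (x + h) - f x - 'd f x h| <= e * `|h|.
Proof.
move=> /diff_locally/eqaddoP df e e0; apply: filterS (df e e0) => h /=.
by rewrite !fctE /= opprD addrA [x + h]addrC.
Qed.

Lemma diff_quot_cvg m (f : 'rV[R]_n -> 'rV[R]_m) x w : differentiable f x ->
  p.1^-1 *: (f (x + p.1 *: p.2) - f x) @[p --> at0 w] --> 'd f x w.
Proof.
move=> df.
have c1 : 'd f x p.2 @[p --> at0 w] --> 'd f x w.
  have cd : continuous ('d f x) by exact: diff_continuous.
  have c0 : p.2 @[p --> at0 w] --> w by exact: cvg_snd.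
  exact: (cvg_comp _ _ c0 (cd w)).
pose r h := f (x + h) - f x - 'd f x h.
have ro e : 0 < e -> \forall h \near (0 : 'rV[R]_n), `|r h| <= e * `|h| ^+ 1.
  by move=> e0; apply: filterS (diff_littleo df e0) => h; rewrite expr1.
have c2 := littleo_quot_cvg0 w ro.
rewrite -['d f x w]addr0; apply: cvg_trans (cvgD c1 c2); apply: near_eq_cvg.
apply: filterS (near_prod_pos w) => -[t v] /= t0.
by rewrite fctE /= expr1 /r ['d f x (t *: v)]linearZ scalerBr scalerA mulVf ?gt_eqF //
  scale1r addrC subrK.
Qed.

End JointLimits.

(** * Second-order Taylor expansion at a stationary point *)

Section Taylor.
Context {R : realType}.

(** Serves to differentiate the gradient of the Lagrangian, whose explicit formula is available only
    near the point. *)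
Lemma near_eq_differentiable (V W : normedModType R) (f g : V -> W) a :
  (\near a, f a = g a) -> differentiable f a -> differentiable g a.
Proof.
move=> fg df.
have E : g \o shift a = cst (g a) + 'd f a +o_ 0 id.
  apply/eqaddoP => e e0; have /eqaddoP/(_ e e0) := diff_locally df.
  have : \forall h \near (0 : V), f (h + a) = g (h + a).
    by have := fg; rewrite (near_shift 0) /=; apply: filterS => h; rewrite subr0.
  by apply: filterS2 => h /= fgh; rewrite !fctE /= fgh (nbhs_singleton fg).
have dg := diff_unique (diff_continuous df) E.
by apply/diff_locallyP; rewrite dg; split => //; exact: diff_continuous.
Qed.

Context {n : nat}.

Lemma diff_grad (g : 'rV[R]_n -> R) x h : 'd g x h = dotv (grad g x) h.
Proof.
rewrite {1}(row_sum_delta h) linear_sum /dotv; apply: eq_bigr => i _.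
by rewrite linearZ /= !mxE mulrC.
Qed.

Lemma mul_hessian (g : 'rV[R]_n -> R) x h : h *m hessian g x = 'd (grad g) x h.
Proof. exact: mul_rV_lin1. Qed.

Lemma is_derive_line (g : 'rV[R]_n -> R) x h s : differentiable g (x + s *: h) ->
  is_derive s 1 (fun s => g (x + s *: h)) (dotv (grad g (x + s *: h)) h).
Proof.
move=> dg; pose k : R -> 'rV[R]_n := cst x + ( *:%R^~ h).
have dk : is_diff s k (0 + ( *:%R^~ h)) by apply: is_diffD.
have dgk : differentiable (g \o k) s by apply: differentiable_comp.
apply: DeriveDef; first exact: (diff_derivable dgk).
rewrite -diff_grad (deriveE _ dgk) diff_comp //=.
by rewrite diff_val /= add0r scale1r.
Qed.

(** The mean value theorem is applied along the segment to [g] minus its quadratic model; the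
    derivative of that difference is the first-order remainder of the gradient, paired with [h]. *)
Lemma taylor2_littleo (g : 'rV[R]_n -> R) x :
  (\forall z \near x, differentiable g z) -> differentiable (grad g) x ->
  grad g x = 0 -> forall e, 0 < e -> \forall h \near (0 : 'rV[R]_n),
    `|g (x + h) - g x - 2^-1 * dotv (h *m hessian g x) h| <= e * `|h| ^+ 2.
Proof.
(* The divisor [n + 1] absorbs the factor [n] of [norm_dotv_le] and stays nonzero when [n = 0]. *)
move=> dg dG G0 e e0; pose e' := e / n.+1%:R.
have e'0 : 0 < e' by rewrite divr_gt0.
have n1 : \forall h \near (0 : 'rV[R]_n), `|grad g (x + h) - 'd (grad g) x h| <= e' * `|h|.
  by apply: filterS (diff_littleo dG e'0) => h; rewrite G0 subr0.
have n2 : \forall h \near (0 : 'rV[R]_n), differentiable g (x + h).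
  by have := dg; rewrite (near_shift 0) /=; apply: filterS => h; rewrite subr0 addrC.
have [d /= d0 dP] := (nbhs_ballP _ _).1 (filterI n1 n2).
apply/nbhs_ballP; exists d => // h; rewrite -ball_normE /= sub0r normrN => hd.
have inball (s : R) : 0 <= s <= 1 -> ball 0 d (s *: h).
  move=> /andP[s0 s1]; rewrite -ball_normE /= sub0r normrN normrZ ger0_norm //.
  by apply: le_lt_trans hd; rewrite ler_piMl.
pose q := dotv (h *m hessian g x) h.
pose psi s := g (x + s *: h) - q / 2 * s ^+ 2.
pose dpsi s := dotv (grad g (x + s *: h)) h - q * s.
have psi_d (s : R) : 0 <= s <= 1 -> is_derive s 1 psi (dpsi s).
  move=> /inball/dP[_ dgs]; have dl := is_derive_line dgs.
  apply: is_derive_eq; rewrite /dpsi; congr (_ - _).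
  by rewrite /GRing.scale /=; field.
have [||c c01] := @MVT_segment R psi dpsi 0 1 ler01.
- by move=> t; rewrite in_itv /= => /andP[t0 t1]; apply: psi_d; rewrite !ltW.
- apply: continuous_in_subspaceT => t; rewrite inE /= in_itv /= => /psi_d dt.
  by apply: differentiable_continuous; apply/derivable1_diffP; case: dt.
rewrite /psi !scale1r !scale0r addr0 expr0n /= mulr0 subr0 expr1n !mulr1 => E.
rewrite (_ : _ - _ = dpsi c); last by move: E; rewrite -/q; lra.
move: c01; rewrite in_itv /= => c01; have [gc _] := dP _ (inball _ c01).
have -> : dpsi c = dotv (grad g (x + c *: h) - 'd (grad g) x (c *: h)) h.
  by rewrite /dpsi dotvDl dotvNl ['d _ _ (c *: h)]linearZ dotvZl /q mul_hessian [c * _]mulrC.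
apply: (le_trans (norm_dotv_le _ _)).
have ch : `|c *: h| <= `|h|.
  by case/andP: c01 => c0 c1; rewrite normrZ ger0_norm // ler_piMl.
apply: (@le_trans _ _ (n%:R * (e' * `|h| * `|h|))).
  by rewrite ler_wpM2l // ler_wpM2r // (le_trans gc) // ler_pM2l.
rewrite -mulrA -expr2 mulrA ler_wpM2r ?sqr_ge0 // /e' mulrCA ger_pMr //.
by rewrite ler_pdivrMr // mul1r ler_nat.
Qed.

Lemma taylor2_cvg (g : 'rV[R]_n -> R) x (w : 'rV[R]_n) :
  (\forall z \near x, differentiable g z) -> differentiable (grad g) x ->
  grad g x = 0 ->
  (g (x + p.1 *: p.2) - g x) / (2^-1 * p.1 ^+ 2)
    @[p --> filter_prod (0 : R)^'+ (nbhs w)] --> dotv (w *m hessian g x) w.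
Proof.
move=> dg dG G0.
have c1 : dotv (p.2 *m hessian g x) p.2 @[p --> filter_prod (0 : R)^'+ (nbhs w)]
    --> dotv (w *m hessian g x) w.
  apply: cvg_dotv; last exact: cvg_snd.
  under eq_fun do rewrite mul_hessian.
  have cd : continuous ('d (grad g) x) by exact: diff_continuous.
  have c0 : p.2 @[p --> filter_prod (0 : R)^'+ (nbhs w)] --> w by exact: cvg_snd.
  rewrite mul_hessian; exact: (cvg_comp _ _ c0 (cd w)).
pose r h := g (x + h) - g x - 2^-1 * dotv (h *m hessian g x) h.
have c2 : p.1 ^- 2 * r (p.1 *: p.2) @[p --> filter_prod (0 : R)^'+ (nbhs w)] --> (0 : R).
  exact: (littleo_quot_cvg0 w (taylor2_littleo dg dG G0)).
have c3 : dotv (p.2 *m hessian g x) p.2 + 2 * (p.1 ^- 2 * r (p.1 *: p.2))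
    @[p --> filter_prod (0 : R)^'+ (nbhs w)] --> dotv (w *m hessian g x) w + 2 * 0.
  by apply: cvgD => //; exact: cvgMl_tmp.
rewrite mulr0 addr0 in c3.
apply: cvg_trans c3; apply: near_eq_cvg.
apply: filterS (near_prod_pos w) => -[t v] /= t0.
rewrite /r -scalemxAl dotvZl dotvZr.
by field; rewrite gt_eqF.
Qed.

End Taylor.

(** * Semidifferentiability and expansion from joint convergence of second-order quotients *)

Section SecondOrderLimit.
Context {R : realType} {n : nat}.
Variables (h : 'rV[R]_n -> R) (x : 'rV[R]_n) (q : 'rV[R]_n -> R).
Local Notation at0 z := (filter_prod (0 : R)^'+ (nbhs (z : 'rV[R]_n))).

Definition plain_quot2 (p : R * 'rV[R]_n) : R :=
  (h (x + p.1 *: p.2) - h x) / (2^-1 * p.1 ^+ 2).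

Hypothesis quot2_cvg : forall w, plain_quot2 p @[p --> at0 w] --> q w.

(** The first-order quotient is [t / 2] times a convergent second-order one. *)
Lemma semiquot_cvg0 w : semiquot h x p @[p --> at0 w] --> (0 : R).
Proof.
have c : plain_quot2 p * (p.1 * 2^-1) @[p --> at0 w] --> q w * (0 * 2^-1).
  by apply: cvgM => //; apply: cvgMr_tmp; exact: cvg_fst_at0.
rewrite mul0r mulr0 in c; apply: cvg_trans c; apply: near_eq_cvg.
apply: filterS (near_prod_pos w) => -[t v] /= t0.
by rewrite /plain_quot2 /semiquot /=; field; rewrite gt_eqF.
Qed.

Lemma semideriv_eq0 w : semideriv h x w = 0.
Proof. by apply: cvg_lim; [exact: Rhausdorff|exact: semiquot_cvg0]. Qed.

Lemma semiquot2E : semiquot2 h x = plain_quot2.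
Proof.
by apply/funext => p; rewrite /semiquot2 semideriv_eq0 mulr0 subr0.
Qed.

Lemma twice_semidifferentiable_quot2 : twice_semidifferentiable h x.
Proof.
split=> w; apply/cvg_ex; first by exists 0; exact: semiquot_cvg0.
by exists (q w); rewrite semiquot2E; exact: quot2_cvg.
Qed.

Lemma semideriv2_quot2 : semideriv2 h x = q.
Proof.
apply/funext => w; rewrite /semideriv2 semiquot2E.
by apply: cvg_lim; [exact: Rhausdorff|exact: quot2_cvg].
Qed.

(** Both parametrizations reach the same point: the quotient at [(t, s *: w)] is [s ^+ 2] times the
    one at [(s * t, w)]. *)
Lemma quot2_homogeneous s w : 0 < s -> q (s *: w) = s ^+ 2 * q w.
Proof.
move=> s0; have c1 : s ^+ 2 * plain_quot2 (s * p.1, p.2) @[p --> at0 w] --> s ^+ 2 * q w.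
  apply: cvgMl_tmp.
  have c : (s * p.1, p.2) @[p --> at0 w] --> at0 w.
    have ct : s * p.1 @[p --> at0 w] --> (0 : R)^'+.
      have cs : s * t @[t --> (0 : R)^'+] --> (0 : R)^'+.
        move=> A /= A0.
        have c0 : s * t @[t --> (0 : R)^'+] --> s * 0.
          by apply: cvgMl_tmp; exact: (cvg_at_right_filter cvg_id).
        rewrite mulr0 in c0.
        have := c0 [set t | 0 < t -> A t] A0.
        have : \forall t \near (0 : R)^'+, 0 < t by exact: nbhs_right_gt.
        by apply: filterS2 => t t0; apply; rewrite mulr_gt0.
      exact: (cvg_comp _ _ cvg_fst cs).
    exact: (cvg_pair ct cvg_snd).
  exact: (cvg_comp _ _ c (@quot2_cvg w)).
have c2 : plain_quot2 (p.1, s *: p.2) @[p --> at0 w] --> q (s *: w).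
  have c : (p.1, s *: p.2) @[p --> at0 w] --> at0 (s *: w).
    have cs : s *: p.2 @[p --> at0 w] --> s *: w.
      by apply: cvgZl_tmp; exact: cvg_snd.
    exact: (cvg_pair cvg_fst cs).
  exact: (cvg_comp _ _ c (@quot2_cvg (s *: w))).
have c3 : plain_quot2 (p.1, s *: p.2) @[p --> at0 w] --> s ^+ 2 * q w.
  apply: cvg_trans c1; apply: near_eq_cvg.
  apply: filterS (near_prod_pos w) => -[t v] /= t0.
  rewrite /plain_quot2 /= scalerA [t * s]mulrC.
  by field; rewrite !gt_eqF.
exact: (cvg_unique _ c2 c3).
Qed.

(** Convergence is joint in the direction: a neighbourhood on which the quotients are close to [q w]
    also surrounds every nearby [v], so the bound passes to [q v]. *)
Lemma quot2_continuous : continuous q.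
Proof.
move=> w; apply/(@cvgrPdist_le _ _ _ (nbhs w)) => e e0.
have [[A B] [A0 B0] AB] : \forall p \near at0 w, `|q w - plain_quot2 p| <= e.
  by move/cvgrPdist_le: (@quot2_cvg w); exact.
have nB : nbhs w (interior B) by exact: nbhs_interior B0.
apply: filterS nB => v nBv.
have c : `|q w - plain_quot2 p| @[p --> at0 v] --> `|q w - q v|.
  by apply: cvg_norm; apply: cvgB; [exact: cvg_cst|exact: quot2_cvg].
have nle : \forall p \near at0 v, `|q w - plain_quot2 p| <= e.
  by exists (A, B) => //= p pAB; exact: AB.
exact: (cvgr_to_le c nle).
Qed.

(** Joint convergence and continuity of [q] give the bound near each direction; compactness of the
    unit ball makes it uniform. *)
Lemma quot2_uniform e : 0 < e ->
  \forall t \near (0 : R)^'+, forall w, `|w| <= 1 -> `|plain_quot2 (t, w) - q w| <= e.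
Proof.
move=> e0; have e20 : 0 < e / 2 by rewrite divr_gt0.
have near_le := (@compact_near_coveringP _ _).1 (@compact_norm_le R n 1)
  _ (0 : R)^'+ (fun t w => `|plain_quot2 (t, w) - q w| <= e) _ _.
apply: near_le => w _.
have n1 : \forall u \near w & t \near (0 : R)^'+, `|q w - plain_quot2 (t, u)| <= e / 2.
  have c : (y.2, y.1) @[y --> filter_prod (nbhs w) (0 : R)^'+] --> at0 w.
    exact: (cvg_pair cvg_snd cvg_fst).
  have nq : \forall p \near at0 w, `|q w - plain_quot2 p| <= e / 2.
    by move/cvgrPdist_le: (@quot2_cvg w); exact.
  exact: (c _ nq).
have n2 : \forall u \near w & t \near (0 : R)^'+, `|q w - q u| <= e / 2.
  have nq : \forall u \near w, `|q w - q u| <= e / 2.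
    by move/(@cvgrPdist_le _ _ _ (nbhs w)): (@quot2_continuous w); exact.
  exact: (cvg_fst nq).
apply: filterS2 n1 n2 => -[u t] /= n1 n2.
rewrite (_ : _ - _ = (q w - q u) - (q w - plain_quot2 (t, u))); last by ring.
by apply: (le_trans (ler_normB _ _)); lra.
Qed.

(** Writing [z - x = t *: w] with [t = |z - x|] puts [w] in the unit ball, where convergence is
    uniform; homogeneity turns [q (z - x)] into [t ^+ 2 * q w]. The sup norm suffices, being bounded
    by [enorm]. *)
Lemma quot2_expansion :
  (fun z => h z - (h x + 2^-1 * q (z - x))) =o_x (fun z => enorm (z - x) ^+ 2).
Proof.
apply/eqoP => e e0.
(* Homogeneity with factor [2] gives [q 0 = 4 * q 0]. *)
have q0 : q 0 = 0.
  have := @quot2_homogeneous 2 0 (ltr0Sn _ 1); rewrite scaler0; lra.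
have n1 : \forall t \near (0 : R), 0 < t ->
    forall w, `|w| <= 1 -> `|plain_quot2 (t, w) - q w| <= e := quot2_uniform e0.
have n2 : \forall z \near x, 0 < `|z - x| ->
    forall w, `|w| <= 1 -> `|plain_quot2 (`|z - x|, w) - q w| <= e.
  have [d /= d0 nd] := (nbhs_ballP _ _).1 n1.
  apply: filterS (nbhsx_ballx x d d0) => z; rewrite -ball_normE /= => zd.
  by apply: nd; rewrite /ball /= sub0r normrN normr_id distrC.
apply: filterS n2 => z; have [->|zx] := eqVneq z x.
  by move=> _; rewrite subrr q0 mulr0 addr0 subrr normr0 mulr_ge0 // ltW.
have t0 : 0 < `|z - x| by rewrite normr_gt0 subr_eq0.
set t := `|z - x| in t0 * => /(_ t0 (t^-1 *: (z - x))).
rewrite normrZ normfV normr_id -/t mulVf ?gt_eqF // => /(_ (lexx _)).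
set w := t^-1 *: (z - x).
have zE : z - x = t *: w by rewrite scalerA divff ?gt_eqF // scale1r.
rewrite /plain_quot2 /= -zE [x + (z - x)]addrC subrK => qe.
have te : t ^+ 2 <= enorm (z - x) ^+ 2.
  by rewrite ler_sqr ?nnegrE ?norm_le_enorm ?enorm_ge0 // ltW.
rewrite [in leRHS]ger0_norm ?sqr_ge0 //; apply: (le_trans _ (ler_wpM2l (ltW e0) te)).
rewrite {1}zE quot2_homogeneous //.
rewrite (_ : _ - _ = 2^-1 * t ^+ 2 * ((h z - h x) / (2^-1 * t ^+ 2) - q w)); last first.
  by field; rewrite gt_eqF.
have t20 : 0 <= 2^-1 * t ^+ 2 by rewrite mulr_ge0 ?sqr_ge0.
rewrite normrM ger0_norm //; apply: (le_trans (ler_wpM2l t20 qe)).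
by rewrite mulrC ler_pM2l // ler_piMl ?sqr_ge0 // invf_le1 ?ler1n.
Qed.

End SecondOrderLimit.

(** * Twice epi-differentiability from the same joint limit *)

Section EpiLimit.
Context {R : realType} {n : nat}.
Variables (h : 'rV[R]_n -> R) (x : 'rV[R]_n) (q : 'rV[R]_n -> R).
Local Notation at0 z := (filter_prod (0 : R)^'+ (nbhs (z : 'rV[R]_n))).

Hypothesis quot2_cvg : forall w, plain_quot2 h x p @[p --> at0 w] --> q w.

Lemma diffquot2_EFin t u :
  diffquot2 (EFin \o h) x 0 t u = (plain_quot2 h x (t, u))%:E.
Proof.
by rewrite /diffquot2 /plain_quot2 /= dot0v mulr0 sube0 -EFinB -EFinM.
Qed.

Lemma subderiv2_quot2 w : subderiv2 (EFin \o h) x 0 w = (q w)%:E.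
Proof.
have near_dist e : 0 < e -> \forall p \near at0 w, `|q w - plain_quot2 h x p| <= e.
  by move=> e0; move/cvgrPdist_le: (@quot2_cvg w); exact.
apply/eqP; rewrite eq_le; apply/andP; split.
  apply/lee_addgt0Pr => e e0; apply: limf_einf_le => V FV.
  have [p [Vp dp]] := filter_ex (filterI FV (near_dist e e0)).
  exists p => //; rewrite diffquot2_EFin -surjective_pairing -EFinD lee_fin.
  by move: dp; rewrite ler_distl; lra.
apply/lee_subgt0Pr => e e0; apply: le_limf_einf.
apply: filterS (near_dist e e0) => p.
rewrite diffquot2_EFin -surjective_pairing -EFinB lee_fin ler_distl; lra.
Qed.

(** The constant sequence [w] is a recovery sequence for any [t], because the joint limit exists. *)
Lemma twice_epi_differentiable_quot2 : twice_epi_differentiable (EFin \o h) x 0.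
Proof.
move=> w t t0; exists (fun=> w); first exact: cvg_cst.
rewrite subderiv2_quot2; under eq_fun do rewrite diffquot2_EFin.
apply: cvg_EFin; first by near=> k.
have ct : (t k, w) @[k --> \oo] --> at0 w.
  exact: (cvg_pair (to0_cvg_at_right t0) (cvg_cst w)).
exact: (cvg_comp _ _ ct (@quot2_cvg w)).
Unshelve. all: by end_near. Qed.

End EpiLimit.

(** * Differentiability of the Lagrangian and of its gradient *)

Section LagrangianDerivatives.
Context {R : realType}.

(** Registering the pairing with [lam] as a linear map lets the differential of linear maps and the
    chain rule apply to [dotv lam \o f]. *)
Lemma linear_dotv m (lam : 'rV[R]_m) : linear (dotv lam : 'rV[R]_m -> R^o).
Proof. by move=> a u v; rewrite dotvDr dotvZr. Qed.

HB.instance Definition _ m (lam : 'rV[R]_m) :=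
  GRing.isLinear.Build R 'rV[R]_m R^o *:%R (dotv lam) (linear_dotv lam).

Lemma dotv_continuous m (lam : 'rV[R]_m) : continuous (dotv lam).
Proof. move=> u; exact: (cvg_dotv (cvg_cst lam) (@cvg_id _ (nbhs u))). Qed.

Lemma differentiable_row (V : normedModType R) n (c : V -> 'I_n -> R) x :
  (forall i, differentiable (c ^~ i) x) -> differentiable (fun z => \row_i c z i) x.
Proof.
move=> dc; rewrite (_ : (fun z => _) = \sum_(i < n) fun z => c z i *: delta_mx 0 i).
  by apply: differentiable_sum => i; exact: differentiableZl.
by apply/funext => z; rewrite fct_sumE [LHS]row_sum_delta; apply: eq_bigr => i _; rewrite mxE.
Qed.

Context {n m : nat}.
Variables (phi : 'rV[R]_n -> R) (f : 'rV[R]_n -> 'rV[R]_m) (lam : 'rV[R]_m).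

Local Notation L := (fun x => lagrangian phi f x lam).

Lemma differentiable_dotv_comp z : differentiable f z -> differentiable (dotv lam \o f) z.
Proof.
move=> df; apply: differentiable_comp => //.
by apply: linear_differentiable; exact: dotv_continuous.
Qed.

Lemma differentiable_lagrangian z :
  differentiable phi z -> differentiable f z -> differentiable L z.
Proof.
by move=> dphi df; apply: differentiableD => //; exact: differentiable_dotv_comp.
Qed.

Lemma grad_lagrangian z : differentiable phi z -> differentiable f z ->
  grad L z = grad phi z + \row_i \sum_(k < m) lam 0 k * 'J f z i k.
Proof.
move=> dphi df; apply/rowP => i; rewrite !mxE.
rewrite (_ : L = phi + (dotv lam \o f)) // diffD //; last exact: differentiable_dotv_comp.
rewrite (@diff_comp _ _ _ _ f (dotv lam)) //; last first.
  by apply: linear_differentiable; exact: dotv_continuous.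
rewrite diff_lin /=; last exact: dotv_continuous.
by congr (_ + _); apply: eq_bigr => k _; rewrite mxE.
Qed.

(** Near [x] the gradient equals a combination of [grad phi] and Jacobian entries of [f], each
    differentiable at [x]. *)
Lemma differentiable_grad_lagrangian x :
  twice_differentiable phi x -> twice_differentiable_map f x ->
  differentiable (grad L) x.
Proof.
move=> [nphi dphi] [nf df].
pose G z := grad phi z + \row_i \sum_(k < m) lam 0 k * 'J f z i k.
apply: (@near_eq_differentiable R _ _ G).
  by apply: filterS2 nphi nf => z dpz dfz; rewrite grad_lagrangian.
apply: differentiableD => //; apply: differentiable_row => i.
rewrite (_ : (fun z => _) = \sum_(k < m) fun z => lam 0 k *: ('J f z i k : R^o)); last first.
  by apply/funext => z; rewrite fct_sumE.
apply: differentiable_sum => k; apply: differentiableZ.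
apply: (@differentiable_comp _ _ _ _ (jacobian f) (fun M : 'M[R]_(n, m) => M i k : R^o)) => //.
exact: differentiable_coord.
Qed.

End LagrangianDerivatives.

(** The common source of all three conclusions: the Taylor limit of the Lagrangian plus the envelope
    limit of the penalty. *)
Lemma aug_lagrangian_quot2_cvg (R : realType) (n m : nat) (Theta : set 'rV[R]_m)
  (phi : 'rV[R]_n -> R) (f : 'rV[R]_n -> 'rV[R]_m)
  (xbar : 'rV[R]_n) (lbar : 'rV[R]_m) (rho : R) :
  twice_differentiable phi xbar -> twice_differentiable_map f xbar ->
  grad (fun x => lagrangian phi f x lbar) xbar = 0 ->
  normal_cone Theta (f xbar) lbar ->
  (forall w, critical_cone Theta (f xbar) lbar w ->
     parabolically_derivable Theta (f xbar) w) ->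
  parabolically_regular Theta (f xbar) lbar ->
  0 < rho -> forall w : 'rV[R]_n,
  plain_quot2 (fun x => aug_lagrangian phi f Theta x lbar rho) xbar p
    @[p --> filter_prod (0 : R)^'+ (nbhs w)] -->
  dotv (w *m hessian (fun x => lagrangian phi f x lbar) xbar) w +
  fine (moreau (1 / (2 * rho)) (subderiv2 (delta Theta) (f xbar) lbar)
    ('d f xbar w)).
Proof.
move=> phi2 f2 stat mult pd pr rho0 w; set y := f xbar.
have [nphi dphi] := phi2; have [nf dJf] := f2.
set F := filter_prod _ _.
(* Chosen so that [y + t *: z (t, v) = f (xbar + t *: v)]; it tends to ['d f xbar w]. *)
pose z (p : R * 'rV[R]_n) := p.1^-1 *: (f (xbar + p.1 *: p.2) - y).
have cz : (p.1, z p) @[p --> F] --> filter_prod (0 : R)^'+ (nbhs ('d f xbar w)).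
  have c2 : z p @[p --> F] --> 'd f xbar w.
    exact: diff_quot_cvg (nbhs_singleton nf).
  exact: (cvg_pair cvg_fst c2).
have c1 : penalty_quot Theta y lbar rho p.1 (z p) @[p --> F] -->
    fine (moreau (1 / (2 * rho)) (subderiv2 (delta Theta) y lbar) ('d f xbar w)).
  have c := @penalty_quot_cvg _ _ _ _ _ _ rho0 mult pd pr ('d f xbar w).
  exact: (cvg_comp _ _ cz c).
have c0 := @taylor2_cvg R n (fun x => lagrangian phi f x lbar) xbar w.
have {}c0 := c0 _ (differentiable_grad_lagrangian lbar phi2 f2) stat.
apply: cvg_trans (cvgD (c0 _) c1); last first.
  by apply: filterS2 nphi nf => x; exact: differentiable_lagrangian.
apply: near_eq_cvg; apply: filterS (near_prod_pos w) => -[t v] /= t0.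
have AE x : aug_lagrangian phi f Theta x lbar rho = phi x + penalty Theta lbar rho (f x) by [].
(* The term [t * dotv lbar z] removed in [penalty_quot] equals the increment of [dotv lbar (f x)],
   which the Lagrangian adds to that of [phi]. *)
rewrite fctE /plain_quot2 /penalty_quot /z /= !AE (penalty0 rho0 mult) -/y.
rewrite scalerA divff ?gt_eqF // scale1r [y + _]addrC subrK dotvZr dotvDr dotvNr /lagrangian -/y.
by field; rewrite gt_eqF.
Qed.

Theorem theorem8p3 (R : realType) (n m : nat) (Theta : set 'rV[R]_m)
  (phi : 'rV[R]_n -> R) (f : 'rV[R]_n -> 'rV[R]_m)
  (xbar : 'rV[R]_n) (lbar : 'rV[R]_m)
  (closed_Theta : closed Theta)
  (convex_Theta : convex_set (Theta : set (convex_lmodType 'rV[R]_m)))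
  (phi_diff2 : twice_differentiable phi xbar)
  (f_diff2 : twice_differentiable_map f xbar)
  (stationary : grad (fun x => lagrangian phi f x lbar) xbar = 0)
  (multiplier : normal_cone Theta (f xbar) lbar)
  (parab_deriv : forall w, critical_cone Theta (f xbar) lbar w ->
     parabolically_derivable Theta (f xbar) w)
  (parab_reg : parabolically_regular Theta (f xbar) lbar)
  (rho : R) (rho_gt0 : 0 < rho) :
  let L := fun x => lagrangian phi f x lbar in
  let AL := fun x => aug_lagrangian phi f Theta x lbar rho in
  [/\ twice_semidifferentiable AL xbar /\
      forall w : 'rV[R]_n,
        (semideriv2 AL xbar w)%:E =
        ((dotv (w *m hessian L xbar) w)%:E
         + moreau (1 / (2 * rho))
             (subderiv2 (delta Theta) (f xbar) lbar) ('d f xbar w))%E,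
      (fun x => AL x - (phi xbar + 2^-1 * semideriv2 AL xbar (x - xbar)))
        =o_xbar (fun x => enorm (x - xbar) ^+ 2) &
      twice_epi_differentiable (EFin \o AL) xbar 0 /\
      forall w : 'rV[R]_n,
        subderiv2 (EFin \o AL) xbar 0 w = (semideriv2 AL xbar w)%:E].
Proof.
move=> L AL.
have q := aug_lagrangian_quot2_cvg phi_diff2 f_diff2 stationary multiplier
  parab_deriv parab_reg rho_gt0.
(* The penalty vanishes at [f xbar], so the constant of the expansion is [phi xbar]. *)
have ALx : AL xbar = phi xbar.
  by rewrite -[RHS]addr0 -(penalty0 rho_gt0 multiplier).
rewrite (semideriv2_quot2 q); split.
- split=> [|w]; first exact: twice_semidifferentiable_quot2 q.
  by rewrite EFinD fineK // (moreau_fin_num rho_gt0 multiplier).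
- by rewrite -ALx; exact: quot2_expansion q.
- split=> [|w]; first exact: twice_epi_differentiable_quot2 q.
  exact: (subderiv2_quot2 q).
Qed.
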